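(* Let $f:X\to Y$ be an onto mapping between continua, let $A\in 2^Y$ and let $n\in\mathbb N$. The following statements hold: (1) if $f^{-1}(A)\in CC_n(X)$, then $A\in CC_n(Y)$; (2) if $f^{-1}(A)\in NWC_n(X)$, then $A\in NWC_n(Y)$; (3) if $f^{-1}(A)\in NB_n(X)$, then $A\in NB_n(Y)$; (4) if $f^{-1}(A)\in NB_n^*(X)$, then $A\in NB_n^*(Y)$; (5) if $f^{-1}(A)\in S_n(X)$, then $A\in S_n(Y)$; (6) if $f^{-1}(A)\in NSC_n(X)$, then $A\in NSC_n(Y)$; (7) if $f^{-1}(A)\in NC_n(X)$, then $A\in NC_n(Y)$.
   Context: All spaces are metric; a mapping is a continuous function; a continuum is a compact connected space with more than one point; $\mathbb N=\{1,2,\dots\}$. For a non-empty space $Z$ and $n\in\mathbb N$: $2^Z$ is the set of non-empty compact subsets of $Z$; $F_n(Z)$ is the set of elements of $2^Z$ with at most $n$ points; $C_n(Z)$ is the set of elements of $2^Z$ with at most $n$ components. A non-empty space $Z$ is (interiors taken in $Z$): - $n$-$Q1$ if there exists $B\in F_n(Z)$ such that for each $x\in Z$ there exists a continuum $D\subset Z$ with $x\in \mathrm{int}(D)$ and $B\cap D\neq\emptyset$; - $n$-$Q2$ if there exists $B\in F_n(Z)$ such that for each $x\in Z$ there exists a continuum $D\subset Z$ with $x\in D$ and $B\cap D\neq\emptyset$; - $n$-$Q3$ if for every $x\in Z$ there exists $B\in F_n(Z)$ with $x\in B$ such that for every non-empty open set $U$ of $Z$ there exists a continuum $D\subset Z$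 with $B\cap D\neq\emptyset\neq D\cap U$; - $n$-$Q4$ if there exists $B\in F_n(Z)$ such that for every non-empty open set $U$ of $Z$ there exists a continuum $D\subset Z$ with $B\cap D\neq\emptyset\neq D\cap U$; - $n$-$Q5$ if for each finite family $\mathcal U$ of non-empty open subsets of $Z$ there exists $D\in C_n(Z)$ with $D\cap U\neq\emptyset$ for every $U\in\mathcal U$; - $n$-$Q6$ if for each collection of $n+1$ non-empty open sets $U_1,\dots,U_{n+1}$ of $Z$ there exists $D\in C_n(Z)$ with $D\cap U_i\neq\emptyset$ for every $i\in\{1,\dots,n+1\}$. For a non-degenerate compact metric space $Z$: $CC_n(Z)=\{A\in 2^Z: A=Z$ or $Z-A$ is $n$-$Q1\}$; $NWC_n(Z)=\{A\in 2^Z: A=Z$ or $Z-A$ is $n$-$Q2\}$; $NB_n(Z)=\{A\in 2^Z: A=Z$ or $Z-A$ is $n$-$Q3\}$; $NB_n^*(Z)=\{A\in 2^Z: A=Z$ or $Z-A$ is $n$-$Q4\}$; $S_n(Z)=\{A\in 2^Z: A=Z$ or $Z-A$ is $n$-$Q5\}$; $NSC_n(Z)=\{A\in 2^Z: A=Z$ or $Z-A$ is $n$-$Q6\}$; $NC_n(Z)=\{A\in 2^Z: Z-A$ has at most $n$ components$\}$. *)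

(* Defs.v *)
From mathcomp Require Import all_boot all_order all_algebra.
From mathcomp Require Import all_classical all_reals topology.

Set Implicit Arguments.
Unset Strict Implicit.
Unset Printing Implicit Defensive.

Local Open Scope classical_set_scope.
Local Open Scope card_scope.

(* The spaces Z of the theory are the subsets Z of an ambient topological space
   T, carrying the induced topology: this covers both T itself (Z = setT) and
   the complements ~` A.  Compactness and connectedness of D `<=` Z do not
   depend on whether D is viewed in Z or in T; openness and interior do, and are
   taken in the induced topology, through the library's [subspace Z]. *)

Section Defs.
Context {T : topologicalType}.
Implicit Types (Z A B D U : set T) (n : nat).

Definition continuum D : Prop :=
  [/\ compact D, connected D & exists x y, [/\ D x, D y & x <> y]].

(* [subspace Z] has carrier T and makes the points outside Z isolated, hence the
   clause U `<=` Z. *)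
Definition open_in Z U : Prop := U `<=` Z /\ open (U : set (subspace Z)).

(* For D `<=` Z, the interior of D in the space Z. *)
Definition int_in Z D : set T := interior (D : set (subspace Z)).

Definition components D : set (set T) := connected_component D @` D.

Definition hyperspace Z : set (set T) :=
  [set K | [/\ K !=set0, K `<=` Z & compact K]].

Definition F_ n Z : set (set T) := [set B | hyperspace Z B /\ B #<= `I_n].

Definition C_ n Z : set (set T) :=
  [set D | hyperspace Z D /\ components D #<= `I_n].

Definition Q1 n Z : Prop :=
  Z !=set0 /\
  exists B, F_ n Z B /\
    forall x, Z x -> exists D,
      [/\ continuum D, D `<=` Z, int_in Z D x & B `&` D !=set0].

Definition Q2 n Z : Prop :=
  Z !=set0 /\
  exists B, F_ n Z B /\
    forall x, Z x -> exists D,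
      [/\ continuum D, D `<=` Z, D x & B `&` D !=set0].

Definition Q3 n Z : Prop :=
  Z !=set0 /\
  forall x, Z x -> exists B, [/\ F_ n Z B, B x &
    forall U, open_in Z U -> U !=set0 -> exists D,
      [/\ continuum D, D `<=` Z, B `&` D !=set0 & D `&` U !=set0]].

Definition Q4 n Z : Prop :=
  Z !=set0 /\
  exists B, F_ n Z B /\
    forall U, open_in Z U -> U !=set0 -> exists D,
      [/\ continuum D, D `<=` Z, B `&` D !=set0 & D `&` U !=set0].

Definition Q5 n Z : Prop :=
  Z !=set0 /\
  forall UU : set (set T), finite_set UU ->
    (forall U, UU U -> open_in Z U /\ U !=set0) ->
    exists D, C_ n Z D /\ forall U, UU U -> D `&` U !=set0.

Definition Q6 n Z : Prop :=
  Z !=set0 /\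
  forall U : 'I_n.+1 -> set T,
    (forall i, open_in Z (U i) /\ U i !=set0) ->
    exists D, C_ n Z D /\ forall i, D `&` U i !=set0.

End Defs.

Section Hyperspaces.
Variables (n : nat) (T : topologicalType).

Definition CC : set (set T) :=
  [set A | hyperspace setT A /\ (A = setT \/ Q1 n (~` A))].
Definition NWC : set (set T) :=
  [set A | hyperspace setT A /\ (A = setT \/ Q2 n (~` A))].
Definition NB : set (set T) :=
  [set A | hyperspace setT A /\ (A = setT \/ Q3 n (~` A))].
Definition NBstar : set (set T) :=
  [set A | hyperspace setT A /\ (A = setT \/ Q4 n (~` A))].
Definition S_ : set (set T) :=
  [set A | hyperspace setT A /\ (A = setT \/ Q5 n (~` A))].
Definition NSC : set (set T) :=
  [set A | hyperspace setT A /\ (A = setT \/ Q6 n (~` A))].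
Definition NC : set (set T) :=
  [set A | hyperspace setT A /\ components (~` A) #<= `I_n].

End Hyperspaces.

Arguments CC : clear implicits.
Arguments NWC : clear implicits.
Arguments NB : clear implicits.
Arguments NBstar : clear implicits.
Arguments S_ : clear implicits.
Arguments NSC : clear implicits.
Arguments NC : clear implicits.

(* Main.v *)
Require Import Defs.
From mathcomp Require Import all_boot all_order all_algebra.
From mathcomp Require Import all_classical all_reals topology.

(** Each witness for the complement of [f @^-1` A] is pushed forward by [f].
    Continuous images of compact connected sets are compact and connected, and
    an image has no more points, and no more components, than its source
    ([components_image_le]).  This settles the properties Q5 and Q6 and the
    counting of components at once.

    For Q1 to Q4 there is one obstruction: a continuum has more than one point,
    whereas [f] may collapse a continuum to a single point.  Such a point lies
    in the open set [~` A] of the continuum [Y], and boundary bumping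
    ([continuum_in_open]) provides a non-degenerate continuum through it inside
    that set.  Boundary bumping rests on the fact that components and
    quasi-components of compact Hausdorff spaces agree
    ([quasicomponent_connected]): if the component of [p] in a closed
    neighbourhood [K] of [p] were [[set p]], then [p] would have a relatively
    clopen neighbourhood in [K] contained in the interior of [K].  Such a set is
    clopen in [Y], hence all of [Y], so that [K] is [Y], whose component at [p]
    is not a single point.

    Q1 moreover asks for interiors, and [f] need not be open.  Instead of a
    single continuum one takes finitely many, whose interiors cover the compact
    fibre over [y]: their images all contain [y], so the union of the images is
    connected, and it is a neighbourhood of [y] because [f] is closed. *)

Set Implicit Arguments.
Unset Strict Implicit.
Unset Printing Implicit Defensive.

Local Open Scope classical_set_scope.
Local Open Scope card_scope.

(** * Compactness *)

(** A finite subcover drawn from a directed family can be replaced by a single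
    member.  This is used twice: to approximate a quasi-component by one
    relatively clopen set, and to gather the continua that cover a fibre. *)
Lemma compact_directed_nbhs (T : topologicalType) (K : set T)
    (G : set (set T)) :
  compact K -> G !=set0 -> setU_closed G ->
  (forall x, K x -> exists2 E, G E & nbhs x E) ->
  exists2 E, G E & forall x, K x -> nbhs x E.
Proof.
move=> /compact_near_coveringP cK [E0 GE0] GU GK.
(* The eventual members along the directed family [G]. *)
pose F : set_system (set T) :=
  filter_from G (fun E => [set E' | G E' /\ E `<=` E']).
have FF : Filter F.
  apply: filter_from_filter; first by exists E0.
  move=> E1 E2 G1 G2; exists (E1 `|` E2); first exact: GU.
  by move=> E [GE]; rewrite subUset => -[? ?]; split; split.
have [|E GE] := cK _ F (fun E x => nbhs x E) FF.
  move=> x /GK[E GE /nbhs_interior xE].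
  exists ((fun x' => nbhs x' E), [set E' | G E' /\ E `<=` E']) => /=.
    by split => //; exists E.
  by move=> [x' E'] /= [x'E [_ EE']]; exact: filterS x'E.
by move=> /(_ E (conj GE (@subset_refl _ E))) KE; exists E.
Qed.

(** * Components of compact Hausdorff spaces *)

Section BoundaryBumping.
Context {T : topologicalType}.
Hypotheses (hT : hausdorff_space T) (cT : compact [set: T]).
Implicit Types (K V U E : set T) (p : T).

Definition relative_clopen_at K p : set (set T) :=
  [set V | [/\ V `<=` K, V p, closed V & closed (K `\` V)]].

Definition quasicomponent K p := \bigcap_(V in relative_clopen_at K p) V.

Lemma relative_clopen_atI K p V W : relative_clopen_at K p V ->
  relative_clopen_at K p W -> relative_clopen_at K p (V `&` W).
Proof.
move=> [VK Vp cV cKV] [WK Wp cW cKW]; split => //.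
- by move=> x [/VK].
- exact: closedI.
- by rewrite setDIr; exact: closedU.
Qed.

Lemma relative_clopen_atT K p : closed K -> K p -> relative_clopen_at K p K.
Proof. by move=> cK Kp; split => //; rewrite setDv; exact: closed0. Qed.

(** The complements of the relatively clopen sets are directed and cover the
    compact set [K `\` U]. *)
Lemma relative_clopen_sub_open K p U : closed K -> K p -> open U ->
  quasicomponent K p `<=` U -> exists2 V, relative_clopen_at K p V & V `<=` U.
Proof.
move=> cK Kp oU QU.
have cKU : compact (K `\` U).
  apply: (subclosed_compact _ cT) => //.
  by apply: closedI => //; exact: open_closedC.
have [|||_ [V KV <-] KUV] :=
    @compact_directed_nbhs _ _ (setC @` relative_clopen_at K p) cKU.
- by exists (~` K); exists K => //; exact: relative_clopen_atT.
- move=> _ _ [V KV <-] [W KW <-]; exists (V `&` W); last by rewrite setCI.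
  exact: relative_clopen_atI.
- move=> x [Kx nUx]; have /existsNP[V /not_implyP[KV nVx]] :
      ~ quasicomponent K p x by move=> /QU.
  exists (~` V); first by exists V.
  by apply: open_nbhs_nbhs; split => //; case: KV => _ _ /closed_openC.
exists V => // x Vx; apply: contrapT => nUx.
have [VK _ _ _] := KV.
by have /nbhs_singleton := KUV x (conj (VK _ Vx) nUx).
Qed.

(** A splitting of the quasi-component into two closed pieces would, by
    normality and compactness, extend to a clopen splitting of some member of
    the family that defines it; that member can then be cut down. *)
Lemma quasicomponent_connected K p :
  closed K -> K p -> connected (quasicomponent K p).
Proof.
move=> cK Kp; set Q := quasicomponent K p.
have Qp : Q p by move=> V [].
have cQ : closed Q by apply: closed_bigI => V [].
(* A closed splitting of [Q] has everything on the side of [p]. *)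
have noF E F : closed E -> closed F -> Q `<=` E `|` F -> E `&` F = set0 ->
    E p -> forall x, Q x -> ~ F x.
  move=> cE cF QEF EF0 Ep x Qx Fx.
  have EF : set_nbhs E (~` F).
    move=> y Ey; apply: open_nbhs_nbhs; split; first exact: closed_openC.
    by move=> Fy; have : (E `&` F) y by []; rewrite EF0.
  have [W EW WF] := compact_normal hT cT cE EF.
  pose H := ~` closure W.
  have oH : open H by exact/closed_openC/closed_closure.
  have [V KV VWH] : exists2 V, relative_clopen_at K p V & V `<=` W° `|` H.
    apply: relative_clopen_sub_open => //.
      by apply: openU => //; exact: open_interior.
    move=> y /QEF[Ey|Fy]; first by left; exact: EW.
    by right => /WF.
  have WH y : W° y -> H y -> False.
    by move=> /interior_subset/subset_closure Wy /(_ Wy).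
  have [VK Vp cV cKV] := KV.
  have : relative_clopen_at K p (V `&` W°).
    split.
    - by move=> y [/VK].
    - by split => //; exact: EW.
    - have -> : V `&` W° = V `&` ~` H.
        apply/seteqP; split=> y [Vy]; first by move=> Wy; split => // /(WH _ Wy).
        by move=> nHy; split => //; have [//|/nHy] := VWH _ Vy.
      by apply: closedI => //; exact: open_closedC.
    - have -> : K `\` (V `&` W°) = (K `\` V) `|` (V `&` ~` W°).
        apply/seteqP; split=> y.
          move=> [Ky nVW]; have [Vy|nVy] := pselect (V y); last by left.
          by right; split => // Wy; apply: nVW.
        case=> [[Ky nVy]|[Vy nWy]]; first by split => // -[].
        by split; [exact: VK|move=> []].
      apply: closedU => //; apply: closedI => //.
      exact/open_closedC/open_interior.
  by move=> /Qx[_ /interior_subset/subset_closure/WF].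
move=> B [b Bb] [C oC BC] [D cD BD].
have cB : closed B by rewrite BD; exact: closedI.
have cQB : closed (Q `\` B).
  have -> : Q `\` B = Q `&` ~` C.
    rewrite BC; apply/seteqP; split=> y [Qy];
      first by move=> nQC; split => // Cy; apply: nQC.
    by move=> nCy; split => // -[].
  by apply: closedI => //; exact: open_closedC.
have BQ : B `<=` Q by rewrite BC => y [].
apply/seteqP; split => // x Qx; apply: contrapT => nBx.
have [Bp|nBp] := pselect (B p).
  apply: (noF B (Q `\` B) cB cQB _ _ Bp x Qx) => //.
  - by move=> y Qy; have [?|?] := pselect (B y); [left|right].
  - by rewrite setDE setICA setICr setI0.
apply: (noF (Q `\` B) B cQB cB _ _ _ b (BQ _ Bb)) => //.
- by move=> y Qy; have [?|?] := pselect (B y); [right|left].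
- by rewrite setIC setDE setICA setICr setI0.
Qed.

(** Boundary bumping, in the weak form that the component of [p] in a closed
    neighbourhood of [p] is not reduced to [p]. *)
Lemma continuum_in_open U p : continuum [set: T] -> open U -> U p ->
  exists D, [/\ continuum D, D `<=` U & D p].
Proof.
move=> [_ conT [a [b [_ _ ab]]]] oU Up.
have [W pW WU] : filter_from (nbhs p) closure U.
  apply: (compact_regular hT cT); first exact: filterT.
  exact: open_nbhs_nbhs.
pose K := closure W.
have cK : closed K by exact: closed_closure.
have pK : nbhs p K by apply: filterS pW; exact: subset_closure.
have Kp : K p by exact: nbhs_singleton.
pose Q := quasicomponent K p.
have Qp : Q p by move=> V [].
have QK : Q `<=` K by move=> x; apply; exact: relative_clopen_atT.
have cQ : compact Q.
  by apply: (subclosed_compact _ cT) => //; apply: closed_bigI => V [].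
have [[q Qq qp]|Q1] := pselect (exists2 q, Q q & q <> p).
  exists Q; split => //; last exact: subset_trans QK WU.
  by split => //; [exact: quasicomponent_connected|exists q, p].
have QKo : Q `<=` K°.
  move=> q Qq; have [->|qp] := pselect (q = p); first exact: pK.
  by exfalso; apply: Q1; exists q.
have [V [VK Vp cV cKV] VKo] :=
  relative_clopen_sub_open cK Kp (@open_interior _ K) QKo.
(* Hence [V] is open, besides being closed. *)
have VE : V = K° `&` ~` (K `\` V).
  apply/seteqP; split=> x; first by move=> Vx; split; [exact: VKo|case].
  by move=> [/interior_subset Kx nKV]; apply: contrapT => nVx; exact: nKV.
have VT : V = [set: T].
  apply: conT; first by exists p.
    exists V; last by rewrite setTI.
    by rewrite VE; apply: openI; [exact: open_interior|exact: closed_openC].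
  by exists V => //; rewrite setTI.
exists [set: T]; split => //; last by rewrite -VT; exact: subset_trans VK WU.
by split => //; exists a, b.
Qed.

(** The form in which boundary bumping repairs images: [E] is the image of a
    continuum, and only fails to be one when it is a single point. *)
Lemma continuum_enlarge U E : continuum [set: T] -> open U -> compact E ->
  connected E -> E !=set0 -> E `<=` U ->
  exists D, [/\ continuum D, E `<=` D & D `<=` U].
Proof.
move=> conT oU cE ctE [p Ep] EU.
have [[q Eq qp]|E1] := pselect (exists2 q, E q & q <> p).
  by exists E; split => //; split => //; exists q, p.
have [D [cD DU Dp]] := continuum_in_open conT oU (EU _ Ep).
exists D; split => // q Eq; have [->//|qp] := pselect (q = p).
by exfalso; apply: E1; exists q.
Qed.

End BoundaryBumping.

(** * Images under continuous maps *)

Lemma open_in_open (T : topologicalType) (Z U : set T) :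
  open Z -> open_in Z U -> open U.
Proof.
move=> oZ [UZ]; rewrite -(open_setSI _ oZ) => oU.
by move: (oU); rewrite (_ : Z `&` U = U)//; exact/setIidPr.
Qed.

Lemma int_inE (T : topologicalType) (Z D : set T) x :
  open Z -> Z x -> int_in Z D x = nbhs x D.
Proof.
move=> oZ Zx; have ZN : nbhs x Z by exact: open_nbhs_nbhs.
rewrite /int_in /interior /mkset /nbhs/= -nbhs_subspace_in//.
apply/propext; split; last exact: filterS.
by move=> /(filterI ZN); apply: filterS => y [Zy]; exact.
Qed.

Section Image.
Context {X Y : topologicalType} (f : X -> Y).
Hypothesis f_cont : continuous f.
Implicit Types (D B : set X) (Z : set Y) (n : nat).

Lemma compact_image D : compact D -> compact (f @` D).
Proof. by apply: continuous_compact; exact: continuous_subspaceT. Qed.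

Lemma connected_image D : connected D -> connected (f @` D).
Proof.
by move=> cD; apply: connected_continuous_connected => //;
  exact: continuous_subspaceT.
Qed.

(** The image of a component of [D] lies in a single component of [f @` D], and
    every component of [f @` D] is reached in this way. *)
Lemma components_image_le D : components (f @` D) #<= components D.
Proof.
pose g (K : set X) := \bigcup_(x in K) connected_component (f @` D) (f x).
apply: card_le_trans (card_image_le g _); apply: subset_card_le.
move=> _ [_ [x Dx <-] <-]; exists (connected_component D x); first by exists x.
apply/seteqP; split => [z [x' Dxx' x'z]|z Dz]; last first.
  by exists x => //; exact: connected_component_refl.
have fDxx' : connected_component (f @` D) (f x) (f x').
  apply: (@connected_component_max _ _ (f @` connected_component D x)).
  - by exists x => //; exact: connected_component_refl.
  - by apply: image_subset; exact: connected_component_sub.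
  - exact/connected_image/component_connected.
  - by exists x'.
by rewrite (same_connected_component fDxx').
Qed.

Lemma hyperspace_image Z D :
  hyperspace (f @^-1` Z) D -> hyperspace Z (f @` D).
Proof.
move=> [[x Dx] DZ cD]; split; [by exists (f x), x| |exact: compact_image].
by move=> _ [y /DZ Zy <-].
Qed.

Lemma F_image n Z B : F_ n (f @^-1` Z) B -> F_ n Z (f @` B).
Proof.
move=> [hB Bn]; split; first exact: hyperspace_image.
exact: card_le_trans (card_image_le _ _) Bn.
Qed.

Lemma C_image n Z D : C_ n (f @^-1` Z) D -> C_ n Z (f @` D).
Proof.
move=> [hD Dn]; split; first exact: hyperspace_image.
exact: card_le_trans (components_image_le _) Dn.
Qed.

End Image.

(** * Transfer of the six properties *)

Section Transfer.
Context {X Y : topologicalType} (f : X -> Y).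
Hypotheses (f_cont : continuous f) (f_onto : set_surj [set: X] [set: Y] f).
Variables (n : nat) (Z : set Y).
Hypothesis oZ : open Z.

Lemma fiber_nonempty y : exists x, f x = y.
Proof. by have [x _ <-] := f_onto (I : [set: Y] y); exists x. Qed.

Lemma preimage_nonempty (U : set Y) : U !=set0 -> f @^-1` U !=set0.
Proof.
by move=> [y Uy]; have [x xy] := fiber_nonempty y; exists x; rewrite /= xy.
Qed.

Lemma preimage_nonemptyW (U : set Y) : f @^-1` U !=set0 -> U !=set0.
Proof. by move=> [x Ux]; exists (f x). Qed.

Lemma open_in_preimage (U : set Y) :
  open_in Z U -> open_in (f @^-1` Z) (f @^-1` U).
Proof.
move=> oU; split; first by move=> x; apply: (oU.1).
apply/open_subspaceW/open_comp; last exact: open_in_open oU.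
by move=> x _; exact: f_cont.
Qed.

Lemma image_meets (D : set X) (U : set Y) :
  D `&` f @^-1` U !=set0 -> f @` D `&` U !=set0.
Proof. by move=> [x [Dx Ux]]; exists (f x); split => //; exists x. Qed.

Lemma Q5_image : Q5 n (f @^-1` Z) -> Q5 n Z.
Proof.
move=> [/preimage_nonemptyW Z0 q]; split => // UU finU oU.
have [||D [/C_image cD DU]] := q ((fun U => f @^-1` U) @` UU).
- exact: finite_image.
- move=> _ [U /oU[oZU U0] <-].
  by split; [exact: open_in_preimage|exact: preimage_nonempty].
exists (f @` D); split; first exact: cD.
by move=> U UUU; apply/image_meets/DU; exists U.
Qed.

Lemma Q6_image : Q6 n (f @^-1` Z) -> Q6 n Z.
Proof.
move=> [/preimage_nonemptyW Z0 q]; split => // U oU.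
have [|D [/C_image cD DU]] := q (fun i => f @^-1` U i).
  move=> i; have [oZU U0] := oU i.
  by split; [exact: open_in_preimage|exact: preimage_nonempty].
by exists (f @` D); split; [exact: cD|move=> i; exact/image_meets/DU].
Qed.

Hypotheses (hY : hausdorff_space Y) (conY : continuum [set: Y]).

Lemma continuum_over_image (D : set X) :
  continuum D -> D `<=` f @^-1` Z ->
  exists E, [/\ continuum E, f @` D `<=` E & E `<=` Z].
Proof.
move=> [cD ctD [x [_ [Dx _ _]]]] DZ; have [cY _ _] := conY.
apply: continuum_enlarge => //.
- exact: compact_image.
- exact: connected_image.
- by exists (f x), x.
- by move=> _ [u /DZ Zu <-].
Qed.

Lemma Q2_image : Q2 n (f @^-1` Z) -> Q2 n Z.
Proof.
move=> [/preimage_nonemptyW Z0 [B [FB q]]]; split => //.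
exists (f @` B); split; first exact: F_image.
move=> y Zy; have [x xy] := fiber_nonempty y; rewrite -xy in Zy *.
have [D [cD DZ Dx [b [Bb Db]]]] := q x Zy.
have [E [cE DE EZ]] := continuum_over_image cD DZ.
exists E; split => //; first by apply: DE; exists x.
by exists (f b); split; [exists b|apply: DE; exists b].
Qed.

(** The common core of Q3 and Q4, which differ only in how [B] is chosen. *)
Lemma reach_image (B : set X) :
  (forall V, open_in (f @^-1` Z) V -> V !=set0 -> exists D,
    [/\ continuum D, D `<=` f @^-1` Z, B `&` D !=set0 & D `&` V !=set0]) ->
  forall U, open_in Z U -> U !=set0 -> exists D,
    [/\ continuum D, D `<=` Z, f @` B `&` D !=set0 & D `&` U !=set0].
Proof.
move=> q U oU U0.
have [D [cD DZ [b [Bb Db]] [u [Du Uu]]]] :=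
  q _ (open_in_preimage oU) (preimage_nonempty U0).
have [E [cE DE EZ]] := continuum_over_image cD DZ.
exists E; split => //.
  by exists (f b); split; [exists b|apply: DE; exists b].
by exists (f u); split => //; apply: DE; exists u.
Qed.

Lemma Q3_image : Q3 n (f @^-1` Z) -> Q3 n Z.
Proof.
move=> [/preimage_nonemptyW Z0 q]; split => // y Zy.
have [x xy] := fiber_nonempty y; rewrite -xy in Zy *.
have [B [FB Bx reachB]] := q x Zy.
exists (f @` B); split; [exact: F_image|by exists x|exact: reach_image].
Qed.

Lemma Q4_image : Q4 n (f @^-1` Z) -> Q4 n Z.
Proof.
move=> [/preimage_nonemptyW Z0 [B [FB q]]]; split => //.
by exists (f @` B); split; [exact: F_image|exact: reach_image].
Qed.

Hypothesis cX : compact [set: X].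

(** Continuous maps from compact spaces to Hausdorff spaces are closed, hence a
    set whose preimage is a neighbourhood of a fibre is a neighbourhood of its
    point. *)
Lemma nbhs_of_fiber (E : set Y) y :
  (forall x, f x = y -> nbhs x (f @^-1` E)) -> nbhs y E.
Proof.
move=> fE; pose C := ~` (f @^-1` E)°.
have cC : closed (f @` C).
  apply: (compact_closed hY); apply: compact_image => //.
  apply: (subclosed_compact _ cX) => //.
  exact/open_closedC/open_interior.
have : nbhs y (~` (f @` C)).
  apply: open_nbhs_nbhs; split; first exact: closed_openC.
  by move=> [x Cx /fE].
apply: filterS => z nz; have [x xz] := fiber_nonempty z; rewrite -xz in nz *.
have : (f @^-1` E)° x by apply: contrapT => Cx; apply: nz; exists x.
exact: interior_subset.
Qed.

Lemma Q1_image : Q1 n (f @^-1` Z) -> Q1 n Z.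
Proof.
move=> [/preimage_nonemptyW Z0 [B [FB q]]]; split => //.
have oX : open (f @^-1` Z) by apply: open_comp => // x _; exact: f_cont.
exists (f @` B); split; first exact: F_image.
move=> y Zy.
(* Directed under union because all members contain [y]; degenerate sets are
   allowed here and enlarged once at the end. *)
pose good : set (set Y) := [set E | [/\ compact E, connected E, E `<=` Z,
  E y & f @` B `&` E !=set0]].
have goodx x : f x = y -> exists2 E, good E & nbhs x (f @^-1` E).
  move=> xy; have Zx : (f @^-1` Z) x by rewrite /= xy.
  have [D [[cD ctD _] DZ]] := q x Zx.
  rewrite int_inE// => xD [b [Bb Db]].
  exists (f @` D); last by apply: filterS xD => u Du; exists u.
  split; [exact: compact_image|exact: connected_image| | |].
  - by move=> _ [u /DZ Zu <-].
  - by exists x => //; exact: nbhs_singleton.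
  - by exists (f b); split; exists b.
have cfib : compact (f @^-1` [set y]).
  apply: (subclosed_compact _ cX) => //.
  apply: closed_comp; first by move=> x _; exact: f_cont.
  by apply: compact_closed => //; exact: compact_set1.
have [|||_ [E gE <-] fibE] := @compact_directed_nbhs _ _
    ((fun E => f @^-1` E) @` good) cfib.
- have [x /goodx[E gE _]] := fiber_nonempty y.
  by exists (f @^-1` E); exists E.
- move=> _ _ [E [cE ctE EZ Ey [z [Bz Ez]]] <-] [F [cF ctF FZ Fy _] <-].
  exists (E `|` F) => //; split.
  - exact: compactU.
  - by apply: connectedU => //; exists y.
  - by rewrite subUset.
  - by left.
  - by exists z; split => //; left.
- by move=> x /goodx[E gE xE]; exists (f @^-1` E) => //; exists E.
have [cE ctE EZ Ey [z [Bz Ez]]] := gE.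
have [cY _ _] := conY.
have [D [cD ED DZ]] :=
  continuum_enlarge hY cY conY oZ cE ctE (ex_intro _ y Ey) EZ.
exists D; split => //; last by exists z; split => //; exact: ED.
by rewrite int_inE//; apply: filterS ED _; exact: nbhs_of_fiber.
Qed.

End Transfer.

Theorem proposition4p2 (R : realType) (X Y : metricType R) (f : X -> Y)
    (hX : continuum [set: X]) (hY : continuum [set: Y])
    (f_cont : continuous f) (f_onto : set_surj [set: X] [set: Y] f)
    (A : set Y) (hA : hyperspace [set: Y] A) (n : nat) (hn : (0 < n)%N) :
  (CC n X (f @^-1` A) -> CC n Y A) /\
  (NWC n X (f @^-1` A) -> NWC n Y A) /\
  (NB n X (f @^-1` A) -> NB n Y A) /\
  (NBstar n X (f @^-1` A) -> NBstar n Y A) /\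
  (S_ n X (f @^-1` A) -> S_ n Y A) /\
  (NSC n X (f @^-1` A) -> NSC n Y A) /\
  (NC n X (f @^-1` A) -> NC n Y A).
Proof.
have [cX _ _] := hX; have [_ _ cA] := hA.
have hausY : hausdorff_space Y by exact: metric_hausdorff.
have oA : open (~` A) by exact/closed_openC/(compact_closed hausY).
have transfer (PX PY : Prop) : (PX -> PY) ->
    hyperspace setT (f @^-1` A) /\ (f @^-1` A = setT \/ PX) ->
    hyperspace setT A /\ (A = setT \/ PY).
  move=> PXY [_ [AT|/PXY]]; split => //; [left|by right].
  apply/seteqP; split => // y _; have [x <-] := fiber_nonempty f_onto y.
  by have : [set: X] x by []; rewrite -AT.
split; first by apply: transfer; exact: Q1_image.
split; first by apply: transfer; exact: Q2_image.
split; first by apply: transfer; exact: Q3_image.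
split; first by apply: transfer; exact: Q4_image.
split; first by apply: transfer; exact: Q5_image.
split; first by apply: transfer; exact: Q6_image.
move=> [_ nA]; split => //.
have fA : f @` (~` (f @^-1` A)) = ~` A.
  apply/seteqP; split=> [_ [x nAx <-]//|y nAy].
  by have [x xy] := fiber_nonempty f_onto y; exists x; rewrite //= xy.
by rewrite -fA; exact: card_le_trans (components_image_le f_cont _) nA.
Qed.
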